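(* Let $\varphi:\mathcal X\to\mathbb C^N$ be continuous and let $n=\dim_{\mathbb C}\mathcal V_{\mathrm{lin}}$, where $\mathcal V_{\mathrm{lin}}=\mathrm{Span}_{\mathbb C}\{\varphi(x)\varphi(x)^*:x\in\mathcal X\}\subseteq\mathbb C^{N\times N}$. Then there exists a point $z\in\mathcal X$ depending only on $\varphi$ such that the function $f:\mathcal X\to\mathbb R$, $f(x)=\sum_{i=1}^d\cos(2\pi(x_i-z_i))$, satisfies \[|L^{\mathrm{OPT}}_g(U)-L_{\beta f}(U)|\ge\log\Big(\frac{\beta^{d/2}}{2n+1}\Big)-\|g-\beta f\|_\infty\] for every model $g(x)=\varphi(x)^*H\varphi(x)$ with $H$ a Hermitian $N\times N$ matrix and every $\beta>0$, where $U$ denotes the uniform distribution on $\mathcal X$.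
   Context: $\mathcal X=[0,1]^d$. $\mathcal P(\mathcal X)$ is the set of probability measures on $\mathcal X$. For a measurable bounded $h:\mathcal X\to\mathbb R$ and $Q\in\mathcal P(\mathcal X)$, $L_h(Q)=\log\int_{\mathcal X}e^{h(x)}\,dQ(x)$. For $P\in\mathcal P(\mathcal X)$, the moment matrix is $\Sigma_P=\int_{\mathcal X}\varphi(x)\varphi(x)^*\,dP(x)$. With $D_{\mathrm{KL}}(P\|Q)=\int\log(dP/dQ)\,dP$, define $D^{\mathrm{OPT}}_{\mathrm{KL}}(\Sigma_P\|\Sigma_Q)=\inf\{D_{\mathrm{KL}}(\tilde P\|\tilde Q):\tilde P,\tilde Q\in\mathcal P(\mathcal X),\ \Sigma_{\tilde P}=\Sigma_P,\ \Sigma_{\tilde Q}=\Sigma_Q\}$, and $L^{\mathrm{OPT}}_g(Q)=\sup_{P\in\mathcal P(\mathcal X)}\big(\int_{\mathcal X}g\,dP-D^{\mathrm{OPT}}_{\mathrm{KL}}(\Sigma_P\|\Sigma_Q)\big)$. *)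

(* Defs.v *)
(* mathcomp-analysis (R : realType), complex numbers R[i]
   from mathcomp-real-closed, matrices and vector spaces from mathcomp. *)
From HB Require Import structures.
From mathcomp Require Import all_boot all_order all_algebra.
From mathcomp Require Import all_classical all_reals all_analysis.
From mathcomp Require Import complex.
Set Implicit Arguments. Unset Strict Implicit. Unset Printing Implicit Defensive.
Import Order.TTheory GRing.Theory Num.Theory.
Import numFieldNormedType.Exports.
Local Open Scope classical_set_scope.
Local Open Scope ring_scope.

Section defs.
Variables (R : realType) (d N : nat).

(* the ambient space of points: d-tuples of reals, with the product
   (tuple) sigma-algebra of Borel sets of R *)
Definition pt := d.-tuple R.

(* X = [0,1]^d *)
Definition cube : set pt := [set x | forall i : 'I_d, 0 <= tnth x i <= 1].

(* probability measures on X: probability measures on the ambient space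
   giving full mass to X *)
Definition probX : set (probability pt R) := [set P | P cube = 1%E].

(* conjugate transpose *)
Definition adjmx m n (A : 'M[R[i]]_(m, n)) : 'M[R[i]]_(n, m) :=
  (map_mx (fun z => z^*) A)^T.

(* phi(x) phi(x)^* *)
Definition outer (phi : pt -> 'cV[R[i]]_N) (x : pt) : 'M[R[i]]_N :=
  phi x *m adjmx (phi x).

(* complex-valued integral over X, computed via real and imaginary parts *)
Definition cintegral (P : probability pt R) (h : pt -> R[i]) : R[i] :=
  Complex (Rintegral P cube (fun x => complex.Re (h x))) (Rintegral P cube (fun x => complex.Im (h x))).

(* the moment matrix Sigma_P = \int phi phi^* dP *)
Definition moment (phi : pt -> 'cV[R[i]]_N) (P : probability pt R) : 'M[R[i]]_N :=
  \matrix_(i, j) cintegral P (fun x => outer phi x i j).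

(* Kullback-Leibler divergence: \int log (dP/dQ) dP if P << Q, +oo otherwise *)
Definition KL (P Q : probability pt R) : \bar R :=
  if pselect (P `<< Q) then
    (\int[P]_x (ln (fine (Radon_Nikodym (charge_of_finite_measure P) Q x)))%:E)%E
  else +oo%E.

(* optimal KL divergence between moment matrices *)
Definition DOPT (phi : pt -> 'cV[R[i]]_N) (P Q : probability pt R) : \bar R :=
  ereal_inf [set KL pq.1 pq.2 | pq in
    [set pq : probability pt R * probability pt R |
       probX pq.1 /\ probX pq.2 /\
       moment phi pq.1 = moment phi P /\ moment phi pq.2 = moment phi Q]].

(* L^OPT_g(Q) *)
Definition LOPT (phi : pt -> 'cV[R[i]]_N) (g : pt -> R) (Q : probability pt R)
  : \bar R :=
  ereal_sup [set (\int[P]_(x in cube) (g x)%:E - DOPT phi P Q)%E | P in probX].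

(* L_h(Q) = log \int e^h dQ *)
Definition Lf (h : pt -> R) (Q : probability pt R) : R :=
  ln (Rintegral Q cube (fun x => expR (h x))).

(* sup norm over X *)
Definition supnorm (h : pt -> R) : \bar R :=
  ereal_sup [set (`|h x|)%:E | x in cube].

(* uniform distribution on X: mass of every box [a,b] in [0,1]^d equals its volume *)
Definition is_uniform (U : probability pt R) : Prop :=
  forall a b : 'I_d -> R, (forall i, 0 <= a i <= b i /\ b i <= 1) ->
    U [set x | forall i, a i <= tnth x i <= b i] = (\prod_i (b i - a i))%:E.

(* V_lin is the complex span of {phi(x) phi(x)^* : x in X} *)
Definition is_span_outer (phi : pt -> 'cV[R[i]]_N) (V : {vspace 'M[R[i]]_N}) : Prop :=
  (forall x, cube x -> outer phi x \in V) /\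
  (forall W : {vspace 'M[R[i]]_N}, (forall x, cube x -> outer phi x \in W) -> (V <= W)%VS).

(* continuity of phi on X (w.r.t. the max norm on R^d and modulus on C) *)
Definition cont_on_cube (phi : pt -> 'cV[R[i]]_N) : Prop :=
  forall x, cube x -> forall e : R, 0 < e -> exists2 del : R, 0 < del &
    forall y, cube y -> (forall i, `|tnth y i - tnth x i| < del) ->
      forall j, `|phi y j 0 - phi x j 0| < (e%:C)%C.

(* the model g(x) = phi(x)^* H phi(x) (real since H is Hermitian) *)
Definition model (phi : pt -> 'cV[R[i]]_N) (H : 'M[R[i]]_N) (x : pt) : R :=
  complex.Re ((adjmx (phi x) *m H *m phi x) 0 0).

(* f(x) = sum_i cos(2 pi (x_i - z_i)) *)
Definition fcos (z : pt) (x : pt) : R :=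
  \sum_(i < d) cos (2 * pi * (tnth x i - tnth z i)).

End defs.

(* Main.v *)
(** Real and imaginary coordinates of [phi(x) phi(x)^*] in a basis of [V_lin] are
    [2n] continuous real functions on the cube, so by Tchakaloff's theorem the
    moment matrix of [U] is also that of a measure [Q] with at most [2n+1] atoms;
    let [z] be an atom of mass at least [1/(2n+1)]. Testing the supremum defining
    [L^OPT] with the Dirac mass at [z], and the infimum defining [D^OPT] with the
    pair [(delta_z, Q)], gives [L^OPT_g(U) >= g(z) - log(2n+1)].

    On the other hand [f(z) = d] and [int e^(beta (f - d)) dU] is the [d]-th power of
      [int_0^1 e^(-2 beta sin^2(pi u)) du <= int_0^1 du / (1 + 2 beta sin^2(pi u))
         = 1 / sqrt(1 + 2 beta) < beta^(-1/2)],
    so that [L_(beta f)(U) <= beta d - (d/2) log beta]. Subtracting the two bounds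
    and using [|g(z) - beta d| <= ||g - beta f||] gives the claim. *)
Require Import Defs.
From HB Require Import structures.
From mathcomp Require Import all_boot all_order all_algebra.
From mathcomp Require Import all_classical all_reals all_analysis.
From mathcomp Require Import measurable_realfun.
From mathcomp Require Import complex ring lra.
Set Implicit Arguments. Unset Strict Implicit. Unset Printing Implicit Defensive.
Import Order.TTheory GRing.Theory Num.Theory.
Import numFieldNormedType.Exports.
Local Open Scope classical_set_scope.
Local Open Scope ring_scope.

(** * The one-dimensional cosine kernel *)

Section kernel.
Variable R : realType.
Implicit Types (b s u x y z : R).

Lemma cos_lipschitz x y : `|cos x - cos y| <= `|x - y|.
Proof.
wlog xy : x y / x < y.
  move=> H; case: (ltgtP x y) => [/H//|/H|->]; last by rewrite !subrr.
  by rewrite distrC (distrC y).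
have [c _ E] : exists2 c, c \in `]x, y[%R & cos y - cos x = - sin c * (y - x).
  apply: MVT => //; apply: continuous_subspaceT => t; exact: continuous_cos.
rewrite distrC E normrM normrN (distrC x) ler_piMl// ler_norml.
by rewrite sin_geN1 sin_le1.
Qed.

(** This is [1 / (1 + 2 b sin^2(pi u))], a majorant of the exponential with an elementary
    primitive. *)
Definition cos_kernel b u : R := (1 + b * (1 - cos (2 * pi * u)))^-1.

Let denom_ge1 b u : 0 < b -> 1 <= 1 + b * (1 - cos (2 * pi * u)).
Proof. by move=> b0; rewrite lerDl (mulr_ge0 (ltW b0))// subr_ge0 cos_le1. Qed.

(** Invert [1 + y <= expR y] at [y = b * (1 - cos (2 * pi * u))]. *)
Lemma expR_le_cos_kernel b u : 0 < b ->
  expR (b * (cos (2 * pi * u) - 1)) <= cos_kernel b u.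
Proof.
move=> b0; have h := @denom_ge1 b u b0.
rewrite /cos_kernel -[leLHS]invrK lef_pV2 ?posrE ?invr_gt0 ?expR_gt0//; last lra.
rewrite -expRN; apply: le_trans (expR_ge1Dx _); lra.
Qed.

(** Both denominators are at least 1, where inversion is 1-Lipschitz, so the constant is that of
    [b * cos (2 * pi * u)]. *)
Lemma cos_kernel_lipschitz b u v : 0 < b ->
  cos_kernel b u <= cos_kernel b v + 2 * pi * b * `|u - v|.
Proof.
move=> b0; rewrite /cos_kernel.
have h1 := @denom_ge1 b u b0; have h2 := @denom_ge1 b v b0.
have h := cos_lipschitz (2 * pi * u) (2 * pi * v).
rewrite -mulrBr normrM (ger0_norm (_ : 0 <= 2 * pi)) in h; last first.
  by rewrite mulr_ge0// pi_ge0.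
set A := 1 + b * (1 - cos (2 * pi * u)) in h1 *.
set B := 1 + b * (1 - cos (2 * pi * v)) in h2 *.
rewrite -lerBlDl.
have -> : A^-1 - B^-1 = (B - A) * (A * B)^-1 by field; apply/andP; split; lra.
have AB : (A * B)^-1 <= 1 by rewrite invf_le1; nra.
apply: (@le_trans _ _ (`|B - A| * (A * B)^-1)).
  by rewrite ler_wpM2r ?ler_norm// invr_ge0; nra.
apply: (@le_trans _ _ `|B - A|); first by rewrite ler_piMr.
have -> : B - A = b * (cos (2 * pi * u) - cos (2 * pi * v)) by rewrite /A /B; ring.
by rewrite normrM gtr0_norm//; move: (ler_wpM2l (ltW b0) h); lra.
Qed.

(** By the subtraction formula this is the tangent of [atan (s * tan (pi * u)) - pi * u], rewritten
    in the double angle; for [s > 0] the denominator never vanishes. *)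
Let quot s u : R :=
  (s - 1) * sin (2 * pi * u) / ((1 + s) + (1 - s) * cos (2 * pi * u)).

(* The branch of [atan (s * tan (pi * u)) / (pi * s)] that is continuous across
   the poles of [tan]. *)
Definition cos_primitive s u : R := u / s + atan (quot s u) / (pi * s).

(** The choice [s ^+ 2 = 1 + 2 * b] turns the denominator of the kernel into
    [(1 + C + s ^+ 2 * (1 - C)) / 2] with [C = cos (2 * pi * u)]. *)
Lemma is_derive_cos_primitive b u : 0 < b ->
  is_derive u 1 (cos_primitive (Num.sqrt (1 + 2 * b))) (cos_kernel b u).
Proof.
move=> b0; set s := Num.sqrt _.
have s2 : s ^+ 2 = 1 + 2 * b by rewrite sqr_sqrtr; lra.
have s0 : 1 < s by rewrite -[ltLHS]sqrtr1 ltr_sqrt; lra.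
have p0 := pi_gt0 R.
have c1 := cos_le1 (2 * pi * u); have c2 := cos_geN1 (2 * pi * u).
have dlin : is_derive u 1 (fun v : R => 2 * pi * v) (2 * pi).
  by apply: is_derive_eq; rewrite scaler1.
have dS : is_derive u 1 (fun v : R => sin (2 * pi * v)) (cos (2 * pi * u) * (2 * pi)).
  by apply: is_derive_eq; rewrite mulrC.
have dC : is_derive u 1 (fun v : R => cos (2 * pi * v)) (- sin (2 * pi * u) * (2 * pi)).
  by apply: is_derive_eq; rewrite mulrC.
have D0 : (1 + s) + (1 - s) * cos (2 * pi * u) != 0 by rewrite gt_eqF//; nra.
have SC := cos2Dsin2 (2 * pi * u).
rewrite /cos_primitive /quot /cos_kernel.
set C := cos (2 * pi * u) in c1 c2 dS D0 SC *.
set S := sin (2 * pi * u) in dC SC *.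
have S2 : S ^+ 2 = 1 - C ^+ 2 by rewrite -SC; ring.
have dq : is_derive u 1 (fun v : R => (s - 1) * sin (2 * pi * v) /
    ((1 + s) + (1 - s) * cos (2 * pi * v)))
    (2 * pi * (s - 1) * (C * (1 + s) - (s - 1)) / (1 + s + (1 - s) * C) ^+ 2).
  apply: is_derive_eq.
  rewrite -/C -/S /GRing.scale/=.
  transitivity (2 * pi * (s - 1) * (C * (1 + s + (1 - s) * C) - (s - 1) * S ^+ 2)
     / (1 + s + (1 - s) * C) ^+ 2); first by field.
  by rewrite S2; congr (_ / _); ring.
apply: is_derive_eq; rewrite /GRing.scale/= -/C -/S.
have E0 : 1 + C + s ^+ 2 * (1 - C) != 0 by rewrite gt_eqF//; nra.
(* In the derivative of [atan], the squared denominator of [quot] cancels against the one in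
   [dq]. *)
have -> : 1 + ((s - 1) * S / (1 + s + (1 - s) * C)) ^+ 2 =
    2 * (1 + C + s ^+ 2 * (1 - C)) / (1 + s + (1 - s) * C) ^+ 2.
  transitivity (((1 + s + (1 - s) * C) ^+ 2 + (s - 1) ^+ 2 * S ^+ 2) /
    (1 + s + (1 - s) * C) ^+ 2); first by field.
  by rewrite S2; congr (_ / _); ring.
have -> : b = (s ^+ 2 - 1) / 2 by rewrite s2; field.
have E1 : 1 + (s ^+ 2 - 1) / 2 * (1 - C) != 0 by rewrite gt_eqF//; nra.
have E2 : 2 + (s ^+ 2 - 1) * (1 - C) != 0 by rewrite gt_eqF//; nra.
move: (negbT (gt_eqF p0)); move: (@pi R) => p pn0.
by field; rewrite ?D0 ?E0 ?E2 ?pn0 ?(gt_eqF (lt_trans ltr01 s0)).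
Qed.

(** Only the linear term sees the shift, [quot] being 1-periodic; so the kernel has integral [s^-1]
    over every period, wherever it starts. *)
Lemma cos_primitive_period s u : s != 0 ->
  cos_primitive s (u + 1) = cos_primitive s u + s^-1.
Proof.
move=> s0; rewrite /cos_primitive /quot mulrDr mulr1.
rewrite (_ : 2 * pi = pi *+ 2) ?mulr2n; last ring.
rewrite -mulr2n sinD2pi cosD2pi.
move: (atan _) (negbT (gt_eqF (pi_gt0 R))) => a; move: (@pi R) => p pn0.
by field; rewrite s0 pn0.
Qed.

(* The mean slope of the primitive on a cell is a value of the kernel there, so up
   to the Lipschitz error it majorises the kernel, and the sum over cells telescopes. *)
Lemma cos_step_majorant b : 0 < b ->
  exists m, forall z, exists t : 'I_m.+1 -> R, [/\ forall k, 0 <= t k,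
    forall (k : 'I_m.+1) x, k%:R / m.+1%:R <= x <= k.+1%:R / m.+1%:R ->
      expR (b * (cos (2 * pi * (x - z)) - 1)) <= t k &
    \sum_k t k / m.+1%:R <= (Num.sqrt b)^-1].
Proof.
move=> b0; set s := Num.sqrt (1 + 2 * b).
have sb0 : 0 < Num.sqrt b by rewrite sqrtr_gt0.
have sbs : Num.sqrt b < s by rewrite ltr_sqrt; lra.
(* The strict gap between [Num.sqrt b] and [s] absorbs the Lipschitz error. The mesh depends on [b]
   alone, so one grid serves every shift [z]. *)
have gap : 0 < (Num.sqrt b)^-1 - s^-1 by rewrite subr_gt0 ltf_pV2 ?posrE//; lra.
have [m mP] : exists m, 2 * pi * b / m.+1%:R <= (Num.sqrt b)^-1 - s^-1.
  set e := _ - _ in gap *.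
  exists (Num.truncn (2 * pi * b / e)); rewrite ler_pdivrMr// -ler_pdivrMl// mulrC.
  exact/ltW/truncnS_gt.
exists m => z; pose P (k : nat) := cos_primitive s (k%:R / m.+1%:R - z).
exists (fun k => m.+1%:R * (P k.+1 - P k) + 2 * pi * b / m.+1%:R).
have m0 : 0 < m.+1%:R :> R by [].
have lip0 : 0 <= 2 * pi * b / m.+1%:R by rewrite divr_ge0// !mulr_ge0 ?pi_ge0// ltW.
have mvt (k : nat) : exists2 c, k%:R / m.+1%:R <= c <= k.+1%:R / m.+1%:R &
    m.+1%:R * (P k.+1 - P k) = cos_kernel b (c - z).
  have lt : k%:R / m.+1%:R - z < k.+1%:R / m.+1%:R - z.
    by rewrite ltrD2r ltr_pM2r ?invr_gt0// ltr_nat.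
  have [||c] := @MVT R (cos_primitive s) (cos_kernel b) _ _ lt.
  - by move=> x _; exact: is_derive_cos_primitive.
  - apply: continuous_subspaceT => x; apply: differentiable_continuous.
    by apply/derivable1_diffP; case: (@is_derive_cos_primitive b x b0).
  rewrite in_itv/= => /andP[c1 c2] E; exists (c + z).
    by rewrite -lerBlDr (ltW c1) -lerBrDr (ltW c2).
  by rewrite addrK /P E -natr1; field; rewrite natr1.
have ker0 c : 0 <= cos_kernel b c by rewrite invr_ge0 (le_trans _ (denom_ge1 _ b0)).
split=> [k|k x /andP[x1 x2]|].
- by have [c _ ->] := mvt k; rewrite addr_ge0.
- have [c /andP[c1 c2] ->] := mvt k.
  apply: le_trans (expR_le_cos_kernel _ b0) _.
  apply: le_trans (cos_kernel_lipschitz _ (c - z) b0) _.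
  rewrite lerD2l ler_wpM2l// ?mulr_ge0 ?pi_ge0 ?(ltW b0)//.
  have e : k.+1%:R / m.+1%:R = k%:R / m.+1%:R + m.+1%:R^-1 :> R.
    by rewrite -natr1 mulrDl mul1r.
  move: x1 x2 c1 c2; rewrite e; move: m.+1%:R^-1 (k%:R / _) => B A x1 x2 c1 c2.
  by rewrite ler_norml; apply/andP; split; lra.
- under eq_bigr => k _ do rewrite mulrDl mulrAC mulfV ?gt_eqF// mul1r.
  rewrite big_split/= -(big_mkord xpredT (fun k => P k.+1 - P k)) telescope_sumr//.
  rewrite sumr_const card_ord -[X in _ + X]mulr_natr divfK ?gt_eqF//.
  have -> : P m.+1 - P 0 = s^-1.
    rewrite /P mulfV ?gt_eqF// mul0r add0r (addrC 1).
    rewrite cos_primitive_period ?gt_eqF//; last lra.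
    ring.
  by rewrite -lerBrDl.
Qed.
End kernel.

(** * Integration against the uniform distribution *)

Section grid.
Variables (R : realType) (d : nat).

Lemma measurable_coord_set (A : 'I_d -> set R) : (forall i, measurable (A i)) ->
  measurable [set x : pt R d | forall i, A i (tnth x i)].
Proof.
move=> mA.
rewrite (_ : [set x | _] = \bigcap_(i in [set: 'I_d]) ((@tnth d R ^~ i) @^-1` A i)).
  apply: fin_bigcap_measurable; first exact: finite_finset.
  by move=> i _; rewrite -[X in measurable X]setTI; exact: measurable_tnth.
by apply/seteqP; split=> x /= h i; [move=> _|]; exact: h.
Qed.

Lemma measurable_box (a b : 'I_d -> R) :
  measurable [set x : pt R d | forall i, a i <= tnth x i <= b i].
Proof.
rewrite (_ : [set x | _] = [set x : pt R d | forall i, [set` `[a i, b i]] (tnth x i)]).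
  by apply: (@measurable_coord_set (fun i => [set` `[a i, b i]])) => i.
by apply/seteqP; split=> x /= h i; move: (h i); rewrite /= in_itv.
Qed.

Lemma measurable_cube : measurable (@cube R d).
Proof. exact: measurable_box. Qed.

Lemma unit_cell m (x : R) : 0 <= x <= 1 ->
  exists k : 'I_m.+1, k%:R / m.+1%:R <= x <= k.+1%:R / m.+1%:R.
Proof.
move=> /andP[x0 x1].
have y0 : 0 <= x * m.+1%:R by rewrite mulr_ge0.
have /andP[t1 t2] := truncn_itv y0.
have [tm|tm] := ltnP (Num.truncn (x * m.+1%:R)) m.+1.
  exists (Ordinal tm) => /=.
  by rewrite ler_pdivrMr// ler_pdivlMr// t1 ltW.
(* Here [x = 1], which belongs to the last closed cell. *)
exists ord_max => /=; rewrite divff// x1 andbT ler_pdivrMr//.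
by rewrite (le_trans _ t1)// ler_nat (leq_trans _ tm).
Qed.

(** Since [is_uniform] prescribes the mass of boxes only, the product is dominated by a step
    function on the grid. The closed boxes overlap on their faces, which is harmless for an upper
    bound. *)
Lemma uniform_integral_prod_le (U : probability (pt R d) R) (h : 'I_d -> R -> R)
    m (t : 'I_d -> 'I_m.+1 -> R) : is_uniform U ->
  (forall i x, 0 <= h i x) -> (forall i, measurable_fun [set: R] (h i)) ->
  (forall i (k : 'I_m.+1) x, k%:R / m.+1%:R <= x <= k.+1%:R / m.+1%:R ->
    h i x <= t i k) ->
  (\int[U]_(x in @cube R d) (\prod_i h i (tnth x i))%:E <=
    (\prod_i \sum_k t i k / m.+1%:R)%R%:E)%E.
Proof.
move=> unifU h0 mh ht.
pose cell (k : 'I_m.+1) : set R := [set x | k%:R / m.+1%:R <= x <= k.+1%:R / m.+1%:R].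
pose box (q : {ffun 'I_d -> 'I_m.+1}) : set (pt R d) :=
  [set x | forall i, (q i)%:R / m.+1%:R <= tnth x i <= (q i).+1%:R / m.+1%:R].
have t0 i k : 0 <= t i k.
  apply: le_trans (h0 i (k%:R / m.+1%:R)) _; apply: ht.
  by rewrite lexx ler_pM2r ?invr_gt0// ler_nat leqnSn.
have mbox q : measurable (box q) by exact: measurable_box.
have Ubox q : U (box q) = (\prod_(i < d) m.+1%:R^-1)%:E.
  rewrite unifU => [|i].
    congr EFin; apply: eq_bigr => i _; rewrite -natr1; field.
    by rewrite gt_eqF// ltr_wpDl.
  rewrite divr_ge0//= ler_pM2r ?invr_gt0// ler_nat leqnSn; split=> //.
  by rewrite ler_pdivrMr// mul1r ler_nat.
apply: (@le_trans _ _ (\int[U]_(x in @cube R d)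
    \sum_(q : {ffun 'I_d -> 'I_m.+1}) (\prod_i t i (q i))%:E * (\1_(box q) x)%:E)%E).
  apply: ge0_le_integral => //.
  - exact: measurable_cube.
  - by move=> x _; rewrite lee_fin prodr_ge0.
  - apply/measurable_EFinP/measurable_funTS.
    apply: measurable_prod => i _; apply: measurableT_comp; first exact: mh.
    exact: measurable_tnth.
  - apply: emeasurable_sum => q; apply/measurable_EFinP/measurable_funTS.
    by apply: measurable_funM => //; exact: measurable_indic.
  - move=> x cx; rewrite -(eq_bigr _ (fun q _ => EFinM _ _)) sumEFin lee_fin.
    apply: (@le_trans _ _ (\prod_i \sum_k t i k * \1_(cell k) (tnth x i))).
      apply: ler_prod => i _; rewrite h0/=.
      have [k kP] := unit_cell m (cx i).
      rewrite (bigD1 k)//= indicE mem_set// mulr1.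
      apply: le_trans (ht _ _ _ kP) _; rewrite lerDl sumr_ge0// => j _.
      by rewrite mulr_ge0// indicE.
    (* Distributivity turns the product of sums into a sum over boxes [q]. The product of the cell
       indicators is at most 1, and it vanishes off [box q]. *)
    rewrite (bigA_distr_bigA (fun i k => t i k * \1_(cell k) (tnth x i))).
    apply: ler_sum => q _; rewrite big_split/= ler_wpM2l ?prodr_ge0//.
    have [xq|xq] := boolP (x \in box q).
      rewrite indicE xq prodr_ile1// => i _.
      by rewrite indicE ler0n lern1 leq_b1.
    rewrite indicE (negbTE xq).
    have [i ni] : exists i, ~ cell (q i) (tnth x i).
      by apply/existsNP; move/negP: xq; apply: contra_not => xq; rewrite inE.
    by rewrite (bigD1 i)//= indicE memNset// mul0r.
rewrite ge0_integral_sum//; last 3 first.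
- exact: measurable_cube.
- move=> q; apply/measurable_EFinP/measurable_funTS.
  by apply: measurable_funM => //; exact: measurable_indic.
- by move=> q x _; rewrite -EFinM lee_fin mulr_ge0 ?prodr_ge0// indicE.
rewrite (bigA_distr_bigA (fun i k => t i k / m.+1%:R)) -sumEFin. apply: lee_sum => q _.
rewrite (ge0_integralZl_EFin _ measurable_cube)//; last 2 first.
- by apply/measurable_EFinP/measurable_funTS; exact: measurable_indic.
- by rewrite prodr_ge0.
rewrite integral_indic//; last exact: measurable_cube.
rewrite big_split/= EFinM lee_wpmul2l ?lee_fin ?prodr_ge0// -(Ubox q).
by apply: le_measure; rewrite ?inE//; apply: measurableI => //; exact: measurable_cube.
Qed.
End grid.

(** * Functions continuous on the cube *)

Section cube_continuous.
Variables (R : realType) (d : nat).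
Implicit Types F G : pt R d -> R.

(* Continuity along an arbitrary filter covers both sequences (measurability) and
   neighbourhood filters of configurations of points (compactness). *)
Definition cube_continuous F := forall (T : Type) (Phi : set_system T)
  (PhiF : Filter Phi) (g : T -> pt R d) x, cube x ->
  (\forall t \near Phi, cube (g t)) ->
  (forall i, tnth (g t) i @[t --> Phi] --> tnth x i) ->
  F (g t) @[t --> Phi] --> F x.

Lemma cube_continuousP F :
  (forall x, cube x -> forall e : R, 0 < e -> exists2 del : R, 0 < del &
    forall y, cube y -> (forall i, `|tnth y i - tnth x i| < del) ->
      `|F y - F x| < e) ->
  cube_continuous F.
Proof.
move=> HF T Phi PhiF g x cx cg gx; apply/cvgrPdist_lt => e e0.
have [del del0 H] := HF x cx e e0.
have near_all : \forall t \near Phi, forall i, `|tnth x i - tnth (g t) i| < del.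
  apply: (@filter_forall _ _ (fun i t => `|tnth x i - tnth (g t) i| < del)) => i.
  by move/cvgrPdist_lt: (gx i); apply.
near=> t; rewrite distrC; apply: H; first by near: t.
by move=> i; rewrite distrC; move: i; near: t.
Unshelve. all: by end_near. Qed.

Lemma cube_continuous_cst c : cube_continuous (fun _ => c).
Proof. by move=> T Phi PhiF g x _ _ _; exact: cvg_cst. Qed.

Lemma cube_continuousD F G : cube_continuous F -> cube_continuous G ->
  cube_continuous (fun x => F x + G x).
Proof.
by move=> cF cG T Phi PhiF g x cx cg gx; apply: cvgD; [exact: cF|exact: cG].
Qed.

Lemma cube_continuousM F G : cube_continuous F -> cube_continuous G ->
  cube_continuous (fun x => F x * G x).
Proof.
by move=> cF cG T Phi PhiF g x cx cg gx; apply: cvgM; [exact: cF|exact: cG].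
Qed.

Lemma cube_continuousB F G : cube_continuous F -> cube_continuous G ->
  cube_continuous (fun x => F x - G x).
Proof.
by move=> cF cG T Phi PhiF g x cx cg gx; apply: cvgB; [exact: cF|exact: cG].
Qed.

Lemma cube_continuous_sum I (r : seq I) (F : I -> pt R d -> R) :
  (forall i, cube_continuous (F i)) ->
  cube_continuous (fun x => \sum_(i <- r) F i x).
Proof.
move=> cF; elim: r => [|i r IH].
  under eq_fun do rewrite big_nil; exact: cube_continuous_cst.
under eq_fun do rewrite big_cons; exact: cube_continuousD.
Qed.

(** On the cube [F] is the pointwise limit of the step functions [h m], which evaluate [F] after
    rounding each coordinate down to the grid. *)
Lemma cube_continuous_measurable F : cube_continuous F ->
  measurable_fun (@cube R d) F.
Proof.
move=> cF.
(* The coordinate 1 rounds to itself and has index [m.+1], hence [m.+2] indices. Cells are half-open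
   so that each point lies in exactly one. *)
pose node m (q : {ffun 'I_d -> 'I_m.+2}) : pt R d := [tuple (q i)%:R / m.+1%:R | i < d].
pose cell m (q : {ffun 'I_d -> 'I_m.+2}) : set (pt R d) :=
  [set x | forall i, [set` `[(q i)%:R / m.+1%:R, (q i).+1%:R / m.+1%:R[] (tnth x i)].
pose h m x : R := \sum_(q : {ffun 'I_d -> 'I_m.+2}) F (node m q) * \1_(cell m q) x.
pose g (x : pt R d) m : pt R d :=
  [tuple (Num.truncn (tnth x i * m.+1%:R))%:R / m.+1%:R | i < d].
have m0 (m : nat) : 0 < m.+1%:R :> R by [].
have y0 (x : pt R d) m i : cube x -> 0 <= tnth x i * m.+1%:R.
  by move=> /(_ i)/andP[? _]; rewrite mulr_ge0.
apply: (@measurable_fun_cvg _ _ _ _ h) => [m|x cx].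
  apply: measurable_sum => q; apply: measurable_funM => //.
  apply/measurable_funTS/measurable_indic.
  exact: (@measurable_coord_set _ _ (fun i =>
    [set` `[(q i)%:R / m.+1%:R, (q i).+1%:R / m.+1%:R[])).
have -> : h ^~ x = F \o g x.
  apply/funext => m /=.
  have tlt i : (Num.truncn (tnth x i * m.+1%:R) < m.+2)%N.
    rewrite truncn_lt_nat ?y0//; have /andP[_ x1] := cx i.
    apply: (@le_lt_trans _ _ m.+1%:R); last by rewrite ltr_nat.
    by rewrite ler_piMl.
  pose q0 : {ffun 'I_d -> 'I_m.+2} := [ffun i => Ordinal (tlt i)].
  have cellE q : cell m q x -> q = q0.
    move=> cq; apply/ffunP => i; apply/val_inj; rewrite ffunE /=.
    have := cq i; rewrite /= in_itv/= ler_pdivrMr// ltr_pdivlMr// => H.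
    by rewrite (truncn_def H).
  have cell0 : cell m q0 x.
    move=> i; rewrite /= in_itv/= ffunE/= ler_pdivrMr// ltr_pdivlMr//.
    exact/truncn_itv/y0.
  rewrite /h (bigD1 q0)//= big1 => [|q qq0].
    rewrite indicE mem_set// mulr1 addr0; congr F.
    by apply: eq_from_tnth => i; rewrite !tnth_mktuple ffunE.
  by rewrite indicE memNset ?mulr0// => /cellE /eqP; rewrite (negbTE qq0).
have gx i m : tnth (g x m) i <= tnth x i < tnth (g x m) i + m.+1%:R^-1.
  have /andP[t1 t2] := truncn_itv (y0 x m i cx).
  rewrite tnth_mktuple ler_pdivrMr// t1/= -[X in _ + X]mul1r -mulrDl.
  by rewrite ltr_pdivlMr// natr1.
apply: cF => //.
  apply: nearW => m i; have /andP[x0 x1] := cx i; have /andP[g1 _] := gx i m.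
  by rewrite (le_trans g1 x1) andbT tnth_mktuple divr_ge0.
move=> i; apply/cvgrPdist_lt => e e0.
near=> m; have /andP[g1 g2] := gx i m.
rewrite ger0_norm ?subr_ge0// ltrBlDl (lt_trans g2)// ltrD2l.
by near: m; exact: (near_infty_natSinv_lt (PosNum e0)).
Unshelve. all: by end_near. Qed.

(** The cube is transported to a product of segments in ['I_d -> R], compact by Tychonoff's theorem,
    where [|F|] attains a maximum. *)
Lemma cube_continuous_bounded F : cube_continuous F ->
  exists M, forall x, cube x -> `|F x| <= M.
Proof.
move=> cF.
pose T := prod_topology (fun _ : 'I_d => R).
pose A : set T := [set u | forall i, [set` `[0, 1]] (u i)].
have cA : compact A.
  apply: (@tychonoff 'I_d (fun=> R) (fun=> [set` `[0, 1]])) => i.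
  exact: segment_compact.
have A0 : A !=set0 by exists (fun _ => 0) => i; rewrite /= in_itv/= lexx ler01.
pose f (u : T) := `|F [tuple u i | i < d]|.
have cf : {within A, continuous f}.
  apply/subspace_continuousP => u Au; apply: cvg_norm; apply: cF.
  - by move=> i; rewrite tnth_mktuple; have := Au i; rewrite /= in_itv.
  - near=> v => i; rewrite tnth_mktuple.
    have Av : A v by near: v; exact: withinT.
    by have := Av i; rewrite /= in_itv.
  - move=> i; rewrite tnth_mktuple.
    have -> : (fun v : T => tnth [tuple v j | j < d] i) = (fun v : T => v i).
      by apply/funext => v; rewrite tnth_mktuple.
    apply: cvg_within_filter; exact: (@proj_continuous 'I_d (fun=> R) i).
have [u /set_mem Au uM] := compact_EVT_max A0 cA cf.
exists (f u) => x cx; have := uM (fun i => tnth x i).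
rewrite /f [X in `|F X|](_ : _ = x); last first.
  by apply: eq_from_tnth => i; rewrite tnth_mktuple.
by apply; apply/mem_set => i; rewrite /= in_itv/=; exact: cx.
Unshelve. all: by end_near. Qed.

Lemma cube_continuous_integrable (P : probability (pt R d) R) F :
  cube_continuous F -> P.-integrable (@cube R d) (EFin \o F).
Proof.
move=> cF; apply: measurable_bounded_integrable.
- exact: measurable_cube.
- by rewrite ltey_eq fin_num_measure//; exact: measurable_cube.
- exact: cube_continuous_measurable.
- have [M MP] := cube_continuous_bounded cF.
  exists M; split; first exact: num_real.
  by move=> r Mr x cx; apply: le_trans (MP _ cx) (ltW Mr).
Qed.

Lemma Rintegral_cube_lin (P : probability (pt R d) R) I (r : seq I)
    (c : I -> R) (F : I -> pt R d -> R) : (forall i, cube_continuous (F i)) ->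
  Rintegral P (@cube R d) (fun x => \sum_(i <- r) c i * F i x) =
  \sum_(i <- r) c i * Rintegral P (@cube R d) (F i).
Proof.
have mc := @measurable_cube R d; move=> cF.
have cc i : cube_continuous (fun x => c i * F i x).
  by apply: cube_continuousM => //; exact: cube_continuous_cst.
elim: r => [|i r IH].
  under eq_fun do rewrite big_nil.
  by rewrite big_nil Rintegral_cst// mul0r.
under eq_fun do rewrite big_cons.
rewrite big_cons RintegralD//; last 2 first.
- exact: (@cube_continuous_integrable P (fun x => c i * F i x)).
- apply: (@cube_continuous_integrable P (fun x => \sum_(i <- r) c i * F i x)).
  exact: cube_continuous_sum.
by rewrite IH RintegralZl//; exact: cube_continuous_integrable.
Qed.
End cube_continuous.

(** * Caratheodory and Tchakaloff *)

Section caratheodory.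
Variable R : realFieldType.

(** Any [D.+2] points in dimension [D] are affinely dependent. Subtracting a multiple of a
    dependency from the weights keeps total mass and barycentre, and the right multiple kills one
    weight. *)
Lemma caratheodory_step D (y : 'I_D.+2 -> 'I_D -> R) (w : 'I_D.+2 -> R) :
  (forall j, 0 <= w j) -> \sum_j w j = 1 ->
  exists (f : 'I_D.+1 -> 'I_D.+2) (u : 'I_D.+1 -> R),
    [/\ forall j, 0 <= u j, \sum_j u j = 1 &
        forall k, \sum_j u j * y (f j) k = \sum_j w j * y j k].
Proof.
move=> w0 w1.
(* The extra column of ones makes a left kernel vector an affine dependency; it exists because rows
   outnumber columns. *)
pose A : 'M[R]_(D.+2, D.+1) :=
  \matrix_(i, j) if unlift ord0 j is Some k then y i k else 1.
have : kermx A != 0.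
  rewrite kermx_eq0 /row_free.
  by apply: contraTneq (rank_leq_col A) => ->; rewrite ltnn.
move=> /matrix0Pn[i [j0 cj0]]; pose c j := kermx A i j.
have cA k : \sum_j c j * A j k = 0.
  by have := congr1 (fun M : 'M[R]_(D.+2, D.+1) => M i k) (mulmx_ker A); rewrite !mxE.
have c0 : \sum_j c j = 0.
  rewrite -[RHS](cA ord0); apply: eq_bigr => j _.
  by rewrite mxE unlift_none mulr1.
have cy k : \sum_j c j * y j k = 0.
  by rewrite -[RHS](cA (lift ord0 k)); apply: eq_bigr => j _; rewrite mxE liftK.
have [j1 cj1] : exists j, 0 < c j.
  apply: contrapT => /forallNP npos.
  have /eqP : \sum_j (- c j) = 0 by rewrite sumrN c0 oppr0.
  rewrite psumr_eq0 => [/allP/(_ j0)|j _]; last by rewrite oppr_ge0 leNgt; exact/negP.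
  by rewrite mem_index_enum oppr_eq0 (negbTE cj0) => /(_ isT).
(* The least ratio over positive coefficients is the largest multiple that keeps every weight
   nonnegative, and the weight at [js] becomes 0. *)
pose js := [arg min_(j < j1 | 0 < c j) (w j / c j)]%O.
have [cjs minjs] : 0 < c js /\ forall j, 0 < c j -> w js / c js <= w j / c j.
  by rewrite /js; case: arg_minP => // j cj Hj; split.
pose t := w js / c js.
have t0 : 0 <= t by rewrite divr_ge0// ltW.
pose v j := w j - t * c j.
have vjs : v js = 0 by rewrite /v /t divfK ?gt_eqF// subrr.
have v0 j : 0 <= v j.
  rewrite subr_ge0; have [cj|cj] := ltP 0 (c j).
    by rewrite -ler_pdivlMr//; exact: minjs.
  by apply: le_trans (w0 j); rewrite mulr_ge0_le0.
have sumv (h : 'I_D.+2 -> R) : \sum_j c j * h j = 0 ->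
    \sum_j v (lift js j) * h (lift js j) = \sum_j w j * h j.
  move=> ch; transitivity (\sum_j v j * h j).
    by rewrite [RHS](bigD1_ord js)//= vjs mul0r add0r.
  have -> : \sum_j w j * h j = \sum_j w j * h j - t * \sum_j c j * h j.
    by rewrite ch mulr0 subr0.
  rewrite mulr_sumr -sumrB.
  by apply: eq_bigr => j _; rewrite /v mulrBl mulrA.
exists (lift js), (v \o lift js); split=> //=.
- have /(sumv (fun=> 1)) : \sum_j c j * 1 = 0 by rewrite -mulr_suml c0 mul0r.
  by rewrite -!mulr_suml !mulr1 w1.
- by move=> k; exact: sumv.
Qed.
End caratheodory.

Lemma cvg_sumr (R : realType) (T : Type) (Phi : set_system T) (PhiF : Filter Phi)
    (I : Type) (r : seq I) (f : I -> T -> R) (l : I -> R) :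
  (forall i, f i t @[t --> Phi] --> l i) ->
  \sum_(i <- r) f i t @[t --> Phi] --> \sum_(i <- r) l i.
Proof.
move=> fl; elim: r => [|i r IH].
  rewrite big_nil; under eq_fun do rewrite big_nil; exact: cvg_cst.
by rewrite big_cons; under eq_fun do rewrite big_cons; exact: cvgD.
Qed.

Section tchakaloff.
Variables (R : realType) (d D : nat) (P : probability (pt R d) R).
Variable F : 'I_D -> pt R d -> R.
Hypothesis cF : forall k, cube_continuous (F k).
Hypothesis P1 : P (@cube R d) = 1%E.

Let mean k := Rintegral P (@cube R d) (F k).

(** A configuration of [D.+1] weighted points is encoded as one point of a real product space, with
    a factor for each weight and for each node coordinate, so that Tychonoff's theorem applies. *)
Let J := ('I_D.+1 + 'I_D.+1 * 'I_d)%type.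
Let T := prod_topology (fun _ : J => R).
Let weight (p : T) j : R := p (inl j).
Let node (p : T) j : pt R d := [tuple p (inr (j, i)) | i < d].
Let bary (p : T) k := \sum_j weight p j * F k (node p j).
Let config : set T :=
  [set p | forall j, [set` `[0, 1]] (p j)] `&` [set p | \sum_j weight p j = 1].
Let cost (p : T) := \sum_k (bary p k - mean k) ^+ 2.

Let coord_continuous (j : J) : continuous (fun p : T => p j).
Proof. exact: (@proj_continuous J (fun=> R) j). Qed.

Let compact_config : compact config.
Proof.
apply: compact_closedI; last first.
  apply: (@preimage_closed _ _ (fun p : T => \sum_j weight p j) [set 1]).
    move=> p _.
    apply: (@cvg_sumr R T (nbhs p) _ _ _ (fun j q => weight q j) (weight p)) => j.
    exact: (@coord_continuous (inl j)).
  exact: closed_eq.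
by apply: (@tychonoff J (fun=> R) (fun=> [set` `[0, 1]])) => i; exact: segment_compact.
Qed.

Let configP p : config p <->
  [/\ forall j, 0 <= weight p j, \sum_j weight p j = 1 & forall j, cube (node p j)].
Proof.
split=> [[p01 ps]|[w0 ws cn]].
  split=> //.
    by move=> j; have := p01 (inl j); rewrite /= in_itv => /andP[].
  by move=> j i; rewrite tnth_mktuple; have := p01 (inr (j, i)); rewrite /= in_itv.
split=> // -[j|[j i]]; rewrite /= in_itv/=.
  rewrite w0/= -ws (bigD1 j)//= lerDl sumr_ge0// => i _; exact: w0.
by have := cn j i; rewrite tnth_mktuple.
Qed.

Let cost_continuous : {within config, continuous cost}.
Proof.
apply/subspace_continuousP => p cp.
apply: (@cvg_sumr R T _ _ _ _ (fun k q => (bary q k - mean k) ^+ 2)) => k.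
apply: (@continuous_cvg _ R R _ _ (fun q => bary q k - mean k) (fun y => y ^+ 2)).
  exact: exprn_continuous.
apply: cvgB; last exact: cvg_cst.
apply: (@cvg_sumr R T _ _ _ _ (fun j q => weight q j * F k (node q j))) => j.
apply: cvgM.
  by apply: cvg_within_filter; exact: (@coord_continuous (inl j)).
have [_ _ cn] := (configP p).1 cp.
apply: cF => //.
  (* [F k] is continuous along points of the cube only; the restriction to [config] keeps the nodes
     there. *)
  near=> q; have /configP[_ _] : config q by near: q; exact: withinT.
  exact.
move=> i; rewrite tnth_mktuple.
have -> : (fun q : T => tnth (node q j) i) = (fun q : T => q (inr (j, i))).
  by apply/funext => q; rewrite tnth_mktuple.
by apply: cvg_within_filter; exact: (@coord_continuous (inr (j, i))).
Unshelve. all: by end_near. Qed.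

Let exists_config (w : 'I_D.+1 -> R) (x : 'I_D.+1 -> pt R d) :
  (forall j, 0 <= w j) -> \sum_j w j = 1 -> (forall j, cube (x j)) ->
  exists2 p, config p & forall k, bary p k = \sum_j w j * F k (x j).
Proof.
move=> w0 w1 cx.
pose p : T := fun a => match a with inl j => w j | inr (j, i) => tnth (x j) i end.
have nodeE j : node p j = x j by apply: eq_from_tnth => i; rewrite tnth_mktuple.
exists p; first by apply/configP; split=> // j; rewrite nodeE.
by move=> k; apply: eq_bigr => j _; rewrite nodeE.
Qed.

(* Moving mass [t] from the barycentre of [p] to [x] costs one extra atom, which
   Caratheodory's step removes. *)
Let move_toward p x t : config p -> cube x -> 0 <= t <= 1 ->
  exists2 q, config q & forall k, bary q k = (1 - t) * bary p k + t * F k x.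
Proof.
move=> /configP[w0 ws cn] cx /andP[t0 t1].
pose w j := if unlift ord0 j is Some i then (1 - t) * weight p i else t.
pose y j := if unlift ord0 j is Some i then node p i else x.
have [j||f [u [u0 us uE]]] := @caratheodory_step R D (fun j k => F k (y j)) w.
- by rewrite /w; case: unlift => // i; rewrite mulr_ge0// subr_ge0.
- rewrite big_ord_recl /w unlift_none.
  under eq_bigr do rewrite liftK.
  by rewrite -mulr_sumr ws mulr1 subrKC.
have [|q cq qE] := @exists_config u (y \o f) u0 us.
  by move=> j; rewrite /y /=; case: unlift.
exists q => // k; rewrite qE uE big_ord_recl /w /y unlift_none addrC.
under eq_bigr do rewrite liftK -mulrA.
by rewrite -mulr_sumr.
Qed.

(* Tchakaloff's theorem: at a configuration closest to the mean, the displacement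
   to the mean pairs nonpositively with every direction [F x - bary p]; averaging
   over [x] shows that the displacement vanishes. *)
Lemma tchakaloff : exists (w : 'I_D.+1 -> R) (x : 'I_D.+1 -> pt R d),
  [/\ forall j, 0 <= w j, \sum_j w j = 1, forall j, cube (x j) &
      forall k, \sum_j w j * F k (x j) = Rintegral P (@cube R d) (F k)].
Proof.
have config0 : config !=set0.
  have [||j|p cp _] := @exists_config (fun j => (j == ord0)%:R)
    (fun=> [tuple 0 | i < d]).
  - by move=> j; rewrite ler0n.
  - by rewrite (bigD1 ord0)//= big1 ?addr0// => j /negbTE ->.
  - by move=> i; rewrite tnth_mktuple lexx ler01.
  by exists p.
have [p /set_mem cp minp] := compact_EVT_min config0 compact_config cost_continuous.
have [w0 ws cn] := (configP p).1 cp.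
exists (weight p), (node p); split=> //.
pose v k := mean k - bary p k.
have dir x : cube x -> \sum_k v k * (F k x - bary p k) <= 0.
  move=> cx; rewrite leNgt; apply/negP; set a := \sum_k _ => a0.
  pose B := \sum_k (F k x - bary p k) ^+ 2.
  have B0 : 0 <= B by apply: sumr_ge0 => k _; exact: sqr_ge0.
  (* With this [t] in []0, 1]], [t * B <= a], so the change of cost [t ^+ 2 * B - 2 * t * a] is at
     most [- t * a < 0], contradicting minimality. *)
  pose t := a / (a + B).
  have aB : 0 < a + B by lra.
  have t0 : 0 < t by rewrite divr_gt0.
  have t1 : t <= 1 by rewrite ler_pdivrMr// mul1r lerDl.
  have [|q cq qE] := @move_toward p x t cp cx; first by rewrite (ltW t0).
  have := minp q (mem_set cq).
  have -> : cost q = t ^+ 2 * B - 2 * t * a + cost p.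
    rewrite /cost /B /a !mulr_sumr -sumrB -big_split/=; apply: eq_bigr => k _.
    by rewrite qE /v; ring.
  rewrite lerDr => h.
  have tE : t * (a + B) = a by rewrite divfK// gt_eqF.
  nra.
pose G x := \sum_k v k * F k x.
have cG : cube_continuous G.
  apply: cube_continuous_sum => k; apply: cube_continuousM => //.
  exact: cube_continuous_cst.
have : Rintegral P (@cube R d) G <=
    Rintegral P (@cube R d) (fun=> \sum_k v k * bary p k).
  apply: le_Rintegral; first exact: measurable_cube.
  - exact: cube_continuous_integrable.
  - exact: (cube_continuous_integrable _ (@cube_continuous_cst _ _ _)).
  - move=> x cx; rewrite -subr_le0 -sumrB.
    by under eq_bigr do rewrite -mulrBr; exact: dir.
rewrite Rintegral_cst; last exact: measurable_cube.
rewrite (_ : fine _ = 1) ?mulr1; last by rewrite /= P1.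
rewrite Rintegral_cube_lin// -subr_le0 -sumrB => h.
(* The averaged inequality [h] says that [v] paired with [mean - bary p], which is [v] itself, is
   nonpositive. *)
have v2 : \sum_k v k ^+ 2 = 0.
  apply/eqP; rewrite eq_le sumr_ge0 ?andbT; last by move=> k _; exact: sqr_ge0.
  by apply: le_trans h; apply: ler_sum => k _; rewrite -mulrBr expr2.
move=> k; apply/eqP; rewrite eq_sym -subr_eq0 -sqrf_eq0.
move/eqP: v2; rewrite psumr_eq0 => [/allP/(_ k)|i _]; last exact: sqr_ge0.
by rewrite mem_index_enum; apply.
Qed.
End tchakaloff.

(** * Discrete measures and their divergence from a point mass *)

Section discrete_probability.
Context (d : measure_display) (T : measurableType d) (R : realType).

Lemma discrete_probability n (w : 'I_n.+1 -> R) (x : 'I_n.+1 -> T) :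
  (forall j, 0 <= w j) -> \sum_j w j = 1 ->
  exists Q : probability T R,
    (forall A, Q A = (\sum_j w j * (x j \in A)%:R)%:E) /\
    (forall D (f : T -> R), measurable D -> measurable_fun D f -> (forall j, D (x j)) ->
      (\int[Q]_(t in D) (f t)%:E)%E = (\sum_j w j * f (x j))%:E).
Proof.
move=> w0 w1.
(* [msum] is indexed by natural numbers; [inord] returns to the ordinal. *)
pose m k : {measure set T -> \bar R} :=
  mscale (NngNum (w0 (inord k))) (\d_(x (inord k))).
pose mu : {measure set T -> \bar R} := msum m n.+1.
have muE A : mu A = (\sum_j w j * (x j \in A)%:R)%:E.
  rewrite /mu /= /msum -sumEFin; apply: eq_bigr => j _.
  by rewrite /m /= /mscale /= inord_val diracE.
have mu1 : mu [set: T] = 1%E.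
  rewrite muE; under eq_bigr do rewrite in_setT mulr1.
  by rewrite w1.
pose Q : probability T R := HB.pack (msum m n.+1)
  (@Measure_isProbability.Build _ _ _ (msum m n.+1) mu1).
exists Q; split=> // D f mD mf Dx.
have ge0E (g : T -> R) : measurable_fun D g -> (forall t, 0 <= g t) ->
    (\int[Q]_(t in D) (g t)%:E)%E = (\sum_j w j * g (x j))%:E.
  move=> mg g0; have mEg : measurable_fun D (EFin \o g) by exact/measurable_EFinP.
  rewrite -sumEFin.
  rewrite (@ge0_integral_measure_sum _ _ _ m _ mD (EFin \o g))//; last first.
    by move=> t _; rewrite lee_fin.
  apply: eq_bigr => j _.
  rewrite (@ge0_integral_mscale _ _ _ _ _ mD)//; last by move=> t _; rewrite lee_fin.
  by rewrite integral_dirac// diracE inord_val mem_set// mul1e.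
(* A signed [f] is reduced to [ge0E] through its positive and negative parts. *)
rewrite integralE.
have -> : (\int[Q]_(t in D) ((fun t => (f t)%:E)^\+ t))%E =
    (\int[Q]_(t in D) (Num.max (f t) 0)%:E)%E.
  by apply: eq_integral => t _; rewrite funeposE EFin_max.
have -> : (\int[Q]_(t in D) ((fun t => (f t)%:E)^\- t))%E =
    (\int[Q]_(t in D) (Num.max (- f t) 0)%:E)%E.
  by apply: eq_integral => t _; rewrite funenegE EFin_max.
have mN : measurable_fun D (fun t => - f t) by exact: measurableT_comp.
rewrite ge0E; [|exact: measurable_maxr|by move=> t; rewrite le_max lexx orbT].
rewrite ge0E; [|exact: measurable_maxr|by move=> t; rewrite le_max lexx orbT].
rewrite -EFinB -sumrB; congr EFin; apply: eq_bigr => j _.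
rewrite -mulrBr; congr (_ * _); rewrite /Num.max.
by case: ifPn; case: ifPn; rewrite -?leNgt; lra.
Qed.

End discrete_probability.

Section KL_dirac.
Variables (R : realType) (d : nat).

Lemma measurable_point (z : pt R d) : measurable [set z].
Proof.
rewrite (_ : [set z] = [set x : pt R d | forall i, [set tnth z i] (tnth x i)]).
  apply: (@measurable_coord_set _ _ (fun i => [set tnth z i])) => i.
  exact: measurable_set1.
by apply/seteqP; split=> [x -> //|x /= h]; exact: eq_from_tnth.
Qed.

(** Integrating the density of the Dirac mass over [[set z]] shows that its value at [z] is the
    inverse of the mass of the atom, and the divergence is the logarithm of that value. *)
Lemma KL_dirac (z : pt R d) (Q : probability (pt R d) R) (c : R) : 0 < c ->
  (c%:E <= Q [set z])%E -> (KL \d_z Q <= (- ln c)%:E)%E.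
Proof.
move=> c0 cQ; have mz := measurable_point z.
(* A [Q]-null set cannot contain [z], as [z] has mass at least [c > 0]. *)
have dom : (\d_z : set (pt R d) -> \bar R) `<< Q.
  move=> N QN A mA AN; rewrite diracE; case: (boolP (z \in A)) => // /set_mem zA.
  have zN : [set z] `<=` N by move=> _ ->; exact: AN.
  by move: cQ; rewrite (QN _ mz zN) lee_fin leNgt c0.
rewrite /KL; case: pselect => // dom'.
set f := Radon_Nikodym _ _.
have ffin t : f t \is a fin_num by exact: Radon_Nikodym_fin_num.
have fz : (f z * Q [set z] = 1)%E.
  transitivity (\d_z [set z] : \bar R); last by rewrite diracE mem_set.
  transitivity (\int[Q]_(t in [set z]) f t)%E.
    rewrite -integral_cst//; apply: eq_integral => t /set_mem -> //.
  exact: esym (@Radon_Nikodym_integral _ _ _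
    (charge_of_finite_measure (\d_z : probability (pt R d) R)) Q _ dom' mz).
have mf : measurable_fun [set: pt R d] f.
  by apply: measurable_int; exact: Radon_Nikodym_integrable.
rewrite integral_dirac//; last first.
  apply/measurable_EFinP/measurableT_comp; first exact: measurable_ln.
  by apply: measurableT_comp => //; exact: fine_measurable.
rewrite diracT mul1e lee_fin.
have Qfin : Q [set z] \is a fin_num by exact: fin_num_measure.
move: fz cQ; rewrite -(fineK (ffin z)) -(fineK Qfin) -EFinM lee_fin => -[] /=.
set a := fine (f z); set q := fine _ => aq cq.
have q0 : 0 < q by exact: lt_le_trans cq.
have -> : a = q^-1 by rewrite -[LHS]mulr1 -(@mulfV _ q) ?gt_eqF// mulrA aq mul1r.
by rewrite lnV ?posrE// lerN2 ler_ln ?posrE.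
Qed.
End KL_dirac.

(** * Compositions of functions continuous on the cube *)

Section cube_continuous_comp.
Variables (R : realType) (d : nat).

Lemma cube_continuous_tnth i : cube_continuous (fun x : pt R d => tnth x i).
Proof. by move=> T Phi PhiF g x _ _; apply. Qed.

Lemma cube_continuous_comp (h : R -> R) (F : pt R d -> R) :
  continuous h -> cube_continuous F -> cube_continuous (fun x => h (F x)).
Proof.
move=> ch cF T Phi PhiF g x cx cg gx.
by apply: (@continuous_cvg _ R R _ _ (fun t => F (g t)) h); [exact: ch|exact: cF].
Qed.

Lemma cube_continuous_fcos (z : pt R d) : cube_continuous (fcos z).
Proof.
apply: cube_continuous_sum => i.
apply: (@cube_continuous_comp cos (fun x => 2 * pi * (tnth x i - tnth z i))).
  exact: continuous_cos.
apply: cube_continuousM; first exact: cube_continuous_cst.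
apply: cube_continuousB; last exact: cube_continuous_cst.
exact: cube_continuous_tnth.
Qed.

End cube_continuous_comp.

(** * Upper bound on the log-partition function of the cosine sum *)

Section log_partition.
Variables (R : realType) (d : nat) (U : probability (pt R d) R).
Hypothesis unifU : is_uniform U.

Lemma uniform_cube : U (@cube R d) = 1%E.
Proof.
rewrite /cube unifU; first by rewrite big1// => i _; rewrite subr0.
by move=> i; rewrite !lexx ler01.
Qed.

Lemma Lf_cos_le (z : pt R d) (b : R) : 0 < b ->
  Lf (fun x => b * fcos z x) U <= b * d%:R - d%:R / 2 * ln b.
Proof.
move=> b0; rewrite /Lf; set I := Rintegral _ _ _.
have mc := @measurable_cube R d.
have cexp : cube_continuous (fun x : pt R d => expR (b * fcos z x)).
  apply: (@cube_continuous_comp _ _ expR (fun x => b * fcos z x)).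
    exact: continuous_expR.
  apply: cube_continuousM; first exact: cube_continuous_cst.
  exact: cube_continuous_fcos.
have fcos_ge (x : pt R d) : - d%:R <= fcos z x.
  rewrite -[d in d%:R]card_ord -sumr_const -sumrN.
  by apply: ler_sum => i _; exact: cos_geN1.
have I0 : 0 < I.
  apply: (@lt_le_trans _ _ (Rintegral U (@cube R d) (fun=> expR (- (b * d%:R))))).
    by rewrite Rintegral_cst// (_ : fine _ = 1) ?mulr1 ?expR_gt0//= uniform_cube.
  apply: le_Rintegral => //.
  - exact: (cube_continuous_integrable _ (@cube_continuous_cst _ _ _)).
  - exact: cube_continuous_integrable.
  - by move=> x _; rewrite ler_expR -mulrN ler_wpM2l// ltW.
suff : I <= expR (b * d%:R - d%:R / 2 * ln b).
  by move=> h; rewrite -[leRHS]expRK ler_ln ?posrE ?expR_gt0.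
(* The mesh [m] is common to all coordinates; only the step heights [t i] depend on [tnth z i]. *)
have [m mP] := cos_step_majorant b0.
have [t tP] := fin_all_exists (fun i : 'I_d => mP (tnth z i)).
pose h i y : R := expR (b * (cos (2 * pi * (y - tnth z i)) - 1)).
(* Factoring out the maximal value [expR (b * d%:R)] leaves a product of one-dimensional
   functions. *)
have hE (x : pt R d) :
    \prod_i h i (tnth x i) = expR (- (b * d%:R)) * expR (b * fcos z x).
  rewrite -expRD -expR_sum; congr expR.
  by rewrite -mulr_sumr sumrB sumr_const card_ord /fcos; ring.
have mprod : measurable_fun (@cube R d) (fun x => \prod_i h i (tnth x i)).
  rewrite (funext hE); apply: cube_continuous_measurable.
  by apply: cube_continuousM => //; exact: cube_continuous_cst.
have IE : (\int[U]_(x in @cube R d) (expR (b * fcos z x))%:E =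
    (expR (b * d%:R))%:E * \int[U]_(x in @cube R d) (\prod_i h i (tnth x i))%:E)%E.
  rewrite -ge0_integralZl_EFin ?expR_ge0//; last 2 first.
  - by move=> x _; rewrite lee_fin prodr_ge0// => i _; exact: expR_ge0.
  - exact/measurable_EFinP.
  by apply: eq_integral => x _; rewrite -EFinM hE mulrA -expRD subrr expR0 mul1r.
have bound : (\int[U]_(x in @cube R d) (\prod_i h i (tnth x i))%:E <=
    (expR (- (d%:R / 2 * ln b)))%:E)%E.
  apply: le_trans (@uniform_integral_prod_le R d U h m t unifU _ _ _) _.
  - by move=> i y; exact: expR_ge0.
  - move=> i; apply: (measurableT_comp (@measurable_expR R)).
    apply: measurable_funM => //; apply: measurable_funB => //.
    apply: (@measurableT_comp _ _ _ _ _ _ cos).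
      by apply: continuous_measurable_fun; exact: continuous_cos.
    by apply: measurable_funM => //; exact: measurable_funB.
  - by move=> i k y yk; have [_ + _] := tP i; apply.
  rewrite lee_fin.
  apply: (@le_trans _ _ (\prod_(i < d) (Num.sqrt b)^-1)).
    apply: ler_prod => i _; have [t0 _ ->] := tP i; rewrite andbT.
    by apply: sumr_ge0 => k _; rewrite divr_ge0.
  rewrite prodr_const card_ord -powR12_sqrt ?(ltW b0)// /powR gt_eqF//.
  by rewrite -expRN -expRM_natl ler_expR; lra.
(* [Rintegral] is the [fine] of this integral, so finiteness excludes its default value. *)
have fin : (\int[U]_(x in @cube R d) (expR (b * fcos z x))%:E)%E \is a fin_num.
  by apply: integrable_fin_num => //; exact: (cube_continuous_integrable U cexp).
rewrite -lee_fin /I /Rintegral fineK// IE expRD EFinM.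
by apply: lee_wpmul2l => //; rewrite lee_fin expR_ge0.
Qed.
End log_partition.

(** * Moment matrices *)

Section complex_parts.
Variable R : realType.
Implicit Types x y : R[i].

Lemma ReD x y : complex.Re (x + y) = complex.Re x + complex.Re y.
Proof. by case: x; case: y. Qed.

Lemma ImD x y : complex.Im (x + y) = complex.Im x + complex.Im y.
Proof. by case: x; case: y. Qed.

Lemma ReM x y :
  complex.Re (x * y) = complex.Re x * complex.Re y - complex.Im x * complex.Im y.
Proof. by case: x; case: y. Qed.

Lemma ImM x y :
  complex.Im (x * y) = complex.Re x * complex.Im y + complex.Im x * complex.Re y.
Proof. by case: x => a b; case: y. Qed.

Lemma Re_conj x : complex.Re x^* = complex.Re x.
Proof. by case: x. Qed.

Lemma Im_conj x : complex.Im x^* = - complex.Im x.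
Proof. by case: x. Qed.

Lemma Re_sum I (r : seq I) (h : I -> R[i]) :
  complex.Re (\sum_(i <- r) h i) = \sum_(i <- r) complex.Re (h i).
Proof. by elim/big_rec2: _ => // i _ y _ <-; rewrite ReD. Qed.

Lemma Im_sum I (r : seq I) (h : I -> R[i]) :
  complex.Im (\sum_(i <- r) h i) = \sum_(i <- r) complex.Im (h i).
Proof. by elim/big_rec2: _ => // i _ y _ <-; rewrite ImD. Qed.

(** Multiplication by ['i] preserves the modulus and carries the imaginary part, up to sign, to the
    real part. *)
Lemma normc_ge_Im x : (`|complex.Im x|%:C)%C <= `|x|.
Proof.
have := normc_ge_Re (x * 'i%C); rewrite ReiNIm normrN normrM.
by rewrite (_ : `|'i%C| = 1) ?mulr1// normc_def/= expr0n add0r expr1n sqrtr1.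
Qed.

End complex_parts.

Section complex_continuous.
Variables (R : realType) (d N : nat).
Implicit Types h g : pt R d -> R[i].

Definition cube_ccontinuous h :=
  cube_continuous (fun x => complex.Re (h x)) /\
  cube_continuous (fun x => complex.Im (h x)).

Lemma cube_ccontinuous_cst c : cube_ccontinuous (fun=> c).
Proof. by split; exact: cube_continuous_cst. Qed.

Lemma cube_ccontinuousM h g : cube_ccontinuous h -> cube_ccontinuous g ->
  cube_ccontinuous (fun x => h x * g x).
Proof.
move=> [hr hi] [gr gi]; split.
  under eq_fun do rewrite ReM.
  by apply: cube_continuousB; exact: cube_continuousM.
under eq_fun do rewrite ImM.
by apply: cube_continuousD; exact: cube_continuousM.
Qed.

Lemma cube_ccontinuous_conj h : cube_ccontinuous h ->
  cube_ccontinuous (fun x => (h x)^*).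
Proof.
move=> [hr hi]; split.
  by under eq_fun do rewrite Re_conj.
under eq_fun do rewrite Im_conj -sub0r.
by apply: cube_continuousB => //; exact: cube_continuous_cst.
Qed.

Lemma cube_ccontinuous_sum I (r : seq I) (h : I -> pt R d -> R[i]) :
  (forall i, cube_ccontinuous (h i)) ->
  cube_ccontinuous (fun x => \sum_(i <- r) h i x).
Proof.
move=> ch; split.
  under eq_fun do rewrite Re_sum.
  by apply: cube_continuous_sum => i; case: (ch i).
under eq_fun do rewrite Im_sum.
by apply: cube_continuous_sum => i; case: (ch i).
Qed.

Lemma cont_on_cube_entry (phi : pt R d -> 'cV[R[i]]_N) j : cont_on_cube phi ->
  cube_ccontinuous (fun x => phi x j 0).
Proof.
move=> cphi; split; apply: cube_continuousP => x cx e e0.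
  have [del del0 H] := cphi x cx e e0; exists del => // y cy yx.
  rewrite -ltcR; apply: le_lt_trans (H y cy yx j).
  rewrite (_ : _ - _ = complex.Re (phi y j 0 - phi x j 0)) ?normc_ge_Re//.
  by case: (phi y j 0); case: (phi x j 0).
have [del del0 H] := cphi x cx e e0; exists del => // y cy yx.
rewrite -ltcR; apply: le_lt_trans (H y cy yx j).
rewrite (_ : _ - _ = complex.Im (phi y j 0 - phi x j 0)) ?normc_ge_Im//.
by case: (phi y j 0); case: (phi x j 0).
Qed.

Variable phi : pt R d -> 'cV[R[i]]_N.
Hypothesis cphi : cont_on_cube phi.

Lemma outer_entry x i j : outer phi x i j = phi x i 0 * (phi x j 0)^*.
Proof. by rewrite /outer /adjmx mxE big_ord1 !mxE. Qed.

Lemma cube_ccontinuous_outer i j : cube_ccontinuous (fun x => outer phi x i j).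
Proof.
under eq_fun do rewrite outer_entry.
apply: cube_ccontinuousM; first exact: cont_on_cube_entry.
by apply: cube_ccontinuous_conj; exact: cont_on_cube_entry.
Qed.

Lemma cube_continuous_model H : cube_continuous (model phi H).
Proof.
suff [] : cube_ccontinuous (fun x => (adjmx (phi x) *m H *m phi x) 0 0) by [].
under eq_fun do rewrite mxE.
apply: cube_ccontinuous_sum => j.
apply: cube_ccontinuousM; last exact: cont_on_cube_entry.
under eq_fun do rewrite mxE.
apply: cube_ccontinuous_sum => i.
apply: cube_ccontinuousM; last exact: cube_ccontinuous_cst.
under eq_fun do rewrite !mxE.
by apply: cube_ccontinuous_conj; exact: cont_on_cube_entry.
Qed.

Variable V : {vspace 'M[R[i]]_N}.
Hypothesis outerV : forall x, cube x -> outer phi x \in V.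

Let a k x : R[i] := coord (vbasis V) k (outer phi x).

(** A coordinate is a linear form on the whole matrix space, hence a fixed combination of the
    entries of [outer phi x]. *)
Let cube_ccontinuous_coord k : cube_ccontinuous (a k).
Proof.
have aE x : a k x = \sum_i \sum_j outer phi x i j * coord (vbasis V) k (delta_mx i j).
  rewrite /a {1}(matrix_sum_delta (outer phi x)) linear_sum; apply: eq_bigr => i _.
  by rewrite linear_sum; apply: eq_bigr => j _; rewrite linearZ.
rewrite (funext aE); apply: cube_ccontinuous_sum => i; apply: cube_ccontinuous_sum => j.
apply: cube_ccontinuousM; last exact: cube_ccontinuous_cst.
exact: cube_ccontinuous_outer.
Qed.

(** These are the [2n] real test functions given to Tchakaloff's theorem. *)
Definition span_coord (k : 'I_(\dim V + \dim V)) (x : pt R d) : R :=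
  match fintype.split k with
  | inl j => complex.Re (a j x) | inr j => complex.Im (a j x)
  end.

Lemma cube_continuous_span_coord k : cube_continuous (span_coord k).
Proof.
by rewrite /span_coord; case: fintype.split => j; case: (cube_ccontinuous_coord j).
Qed.

(** On the cube, real and imaginary parts of each entry of [outer phi x] are fixed real combinations
    of the [span_coord k], so their integrals agree too. *)
Lemma moment_span_coord (P Q : probability (pt R d) R) :
  (forall k, Rintegral P (@cube R d) (span_coord k) =
             Rintegral Q (@cube R d) (span_coord k)) ->
  moment phi P = moment phi Q.
Proof.
move=> PQ; apply/matrixP => i j; rewrite !mxE /cintegral.
pose b k := (vbasis V)`_k i j.
(* [F] stands for the real or the imaginary part, so one argument serves both. *)
have spanE (F : R[i] -> R) (cr ci : 'I_(\dim V) -> R) :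
    (forall x, cube x -> F (outer phi x i j) =
      \sum_k (cr k * complex.Re (a k x) + ci k * complex.Im (a k x))) ->
    Rintegral P (@cube R d) (fun x => F (outer phi x i j)) =
    Rintegral Q (@cube R d) (fun x => F (outer phi x i j)).
  move=> FE.
  pose c (k : 'I_(\dim V + \dim V)) : R :=
    match fintype.split k with inl l => cr l | inr l => ci l end.
  have lin x : cube x -> F (outer phi x i j) = \sum_k c k * span_coord k x.
    move=> cx; rewrite FE// big_split big_split_ord /=; congr (_ + _);
      apply: eq_bigr => k _; rewrite /c /span_coord.
      by rewrite (unsplitK (inl k)).
    by rewrite (unsplitK (inr k)).
  have linI (S : probability (pt R d) R) :
      Rintegral S (@cube R d) (fun x => F (outer phi x i j)) =
      \sum_k c k * Rintegral S (@cube R d) (span_coord k).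
    rewrite -Rintegral_cube_lin; last exact: cube_continuous_span_coord.
    by apply: eq_Rintegral => x /set_mem cx; rewrite lin.
  by rewrite !linI; apply: eq_bigr => k _; rewrite PQ.
have outerE x : cube x -> outer phi x i j = \sum_k a k x * b k.
  move=> cx; rewrite {1}(coord_vbasis (outerV cx)) summxE.
  by apply: eq_bigr => k _; rewrite mxE.
congr Complex.
- apply: (spanE (@complex.Re R) (fun k => complex.Re (b k)) (fun k => - complex.Im (b k))).
  move=> x cx; rewrite outerE// Re_sum; apply: eq_bigr => k _; rewrite ReM; ring.
- apply: (spanE (@complex.Im R) (fun k => complex.Im (b k)) (fun k => complex.Re (b k))).
  move=> x cx; rewrite outerE// Im_sum; apply: eq_bigr => k _; rewrite ImM; ring.
Qed.

End complex_continuous.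

Lemma exists_ge_mean (R : realFieldType) n (w : 'I_n.+1 -> R) :
  \sum_j w j = 1 -> exists j, n.+1%:R^-1 <= w j.
Proof.
move=> w1; apply: contrapT => /forallNP small.
suff : \sum_j w j < \sum_(j < n.+1) n.+1%:R^-1.
  by rewrite w1 sumr_const card_ord -[X in _ < X]mulr_natr mulVf ?pnatr_eq0// ltxx.
apply: ltr_sum; first by apply/hasP; exists ord0; rewrite ?mem_index_enum.
by move=> j _; rewrite ltNge; exact/negP.
Qed.

(** * The heavy atom and the lower bound on [LOPT] *)

Section big_atom.
Variables (R : realType) (d N : nat) (phi : pt R d -> 'cV[R[i]]_N).
Variables (U : probability (pt R d) R) (V : {vspace 'M[R[i]]_N}).
Hypotheses (cphi : cont_on_cube phi) (U1 : probX U).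
Hypothesis outerV : forall x, cube x -> outer phi x \in V.

(** Tchakaloff's theorem with [D = \dim V + \dim V] yields [2n+1] weights of sum 1, one of which is
    at least the mean. No model enters, so [z] is fixed before [H] and [beta]. *)
Lemma moment_big_atom : exists (z : pt R d) (Q : probability (pt R d) R),
  [/\ cube z, probX Q, moment phi Q = moment phi U &
      (((2 * (\dim V)%:R + 1)^-1)%R%:E <= Q [set z])%E].
Proof.
have cs := @cube_continuous_span_coord _ _ _ _ cphi V.
have [w [x [w0 w1 cx wE]]] := tchakaloff cs U1.
have [j wj] := exists_ge_mean w1.
have [Q [QE QI]] := discrete_probability x w0 w1.
exists (x j), Q; split=> //.
- rewrite /probX/= QE; under eq_bigr => i _ do rewrite mem_set// mulr1.
  by rewrite w1.
- apply: (moment_span_coord cphi outerV) => k; rewrite -wE /Rintegral QI//.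
    exact: measurable_cube.
  exact: cube_continuous_measurable.
rewrite QE lee_fin.
have -> : 2 * (\dim V)%:R + 1 = (\dim V + \dim V).+1%:R :> R.
  by rewrite -[RHS]natr1 natrD; ring.
(* Nodes may coincide, so the mass of the point is at least, not exactly, [w j]. *)
apply: le_trans wj _; rewrite (bigD1 j)//= mem_set// mulr1 lerDl.
by apply: sumr_ge0 => i _; rewrite mulr_ge0.
Qed.

Lemma LOPT_ge (z : pt R d) (Q : probability (pt R d) R) (c : R) H :
  cube z -> probX Q -> moment phi Q = moment phi U -> 0 < c ->
  (c%:E <= Q [set z])%E ->
  ((model phi H z + ln c)%:E <= LOPT phi (model phi H) U)%E.
Proof.
move=> cz Q1 QU c0 cQ.
have dz1 : probX (\d_z : probability (pt R d) R) by rewrite /probX/= diracE mem_set.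
apply: (@le_trans _ _ (\int[\d_z]_(x in @cube R d) (model phi H x)%:E -
    DOPT phi \d_z U)%E); last first.
  by apply: ereal_sup_ubound; exists (\d_z : probability (pt R d) R); first exact: dz1.
rewrite integral_dirac//; last 2 first.
- exact: measurable_cube.
- apply/measurable_EFinP; apply: cube_continuous_measurable.
  exact: cube_continuous_model.
rewrite diracE mem_set// mul1e -[ln c]opprK EFinB; apply: leeB => //.
apply: le_trans (KL_dirac c0 cQ); apply: ereal_inf_lbound.
by exists ((\d_z : probability (pt R d) R), Q).
Qed.
End big_atom.

Theorem theorem23 (R : realType) (d N : nat) (phi : pt R d -> 'cV[R[i]]_N)
  (U : probability (pt R d) R) (V : {vspace 'M[R[i]]_N}) :
  cont_on_cube phi -> is_uniform U -> is_span_outer phi V ->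
  exists2 z : pt R d, cube z &
    forall (H : 'M[R[i]]_N) (beta : R), adjmx H = H -> 0 < beta ->
      ((ln (beta `^ (d%:R / 2) / (2 * (\dim V)%:R + 1)))%R%:E
         - supnorm (fun x => model phi H x - beta * fcos z x)%R
       <= `| LOPT phi (model phi H) U - (Lf (fun x => beta * fcos z x)%R U)%:E |)%E.
Proof.
move=> cphi unifU [outerV _].
have [z [Q [cz Q1 QU zQ]]] := moment_big_atom cphi (uniform_cube unifU) outerV.
exists z => // H b _ b0.
set n := 2 * _ + 1 in zQ *.
have n0 : 0 < n by rewrite ltr_wpDl.
have LO : ((model phi H z - ln n)%:E <= LOPT phi (model phi H) U)%E.
  by rewrite -lnV ?posrE//; apply: (LOPT_ge cphi H cz Q1 QU) => //; rewrite invr_gt0.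
have Lb := Lf_cos_le unifU z b0; set L := Lf _ _ in Lb *.
have fz : fcos z z = d%:R.
  rewrite /fcos (eq_bigr (fun=> 1)) ?sumr_const ?card_ord// => i _.
  by rewrite subrr mulr0 cos0.
have sup_ge : ((b * d%:R - model phi H z)%:E <=
    supnorm (fun x => model phi H x - b * fcos z x)%R)%E.
  apply: (@le_trans _ _ (`|model phi H z - b * fcos z z|)%:E); last first.
    by apply: ereal_sup_ubound; exists z.
  by rewrite lee_fin fz distrC ler_norm.
(* The signed difference already suffices. Working in the extended reals also covers an infinite
   [LOPT]. *)
apply: le_trans (lee_abs _).
apply: (@le_trans _ _ ((model phi H z - ln n)%:E - L%:E)%E); last exact: leeB.
apply: (@le_trans _ _ ((ln (b `^ (d%:R / 2) / n))%:E - (b * d%:R - model phi H z)%:E)%E).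
  exact: leeB.
rewrite -!EFinB lee_fin ln_div ?posrE ?powR_gt0// ln_powR; lra.
Qed.
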